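(* Any CONGEST algorithm (possibly randomized, succeeding with probability at least $2/3$) that, given a directed weighted $n$-vertex graph $G$, vertices $s,t$ and a shortest $s$-$t$ path $P_{st}$, solves the Replacement Paths problem, or the Second Simple Shortest Path problem, for $P_{st}$ requires $\Omega\!\left(\frac{n}{\log n}\right)$ rounds in the worst case; this holds even when restricted to input graphs whose undirected diameter is a constant.
   Context: CONGEST model: the communication network is the graph $G=(V,E)$, $n=|V|$; each node has a unique identifier in $\{0,\dots,n-1\}$, knows its own and its neighbours' identifiers and the weights of its incident edges (weights are integers in $\{0,1,\dots,W\}$ with $W=\mathrm{poly}(n)$); computation proceeds in synchronous rounds in which each node may send a message of $O(\log n)$ bits to each neighbour; local computation is free; communication links are bidirectional and unweighted even when $G$ is directed. Complexity is the number of rounds. The undirected diameter $D$ is the diameter of the underlying undirected unweighted graph of $G$. Replacement Paths (RPaths): given $G$, $s,t$, and a shortest $s$-$t$ path $P_{st}$, for each edge $e\in P_{st}$ some vertex must compute the weight of a shortest simple $s$-$t$ path $P_e$ avoiding $e$, and every vertex on $P_e$ must know its successor on $P_e$. Second Simple Shortest Path (2-SiSP): some vertex must compute the weight of a minimum-weight simple $s$-$t$ path not containing at least one edge of $P_{st}$, and each vertex on such a path must know its successor on it. *)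

(* Defs.v *)
From mathcomp Require Import all_boot.
Set Implicit Arguments. Unset Strict Implicit. Unset Printing Implicit Defensive.

Record instance (n : nat) := Instance {
  adj : rel 'I_n;
  wt  : 'I_n -> 'I_n -> nat;        (* weight of edge (u,v), used when adj u v *)
  src : 'I_n;
  dst : 'I_n;
  Pst : seq 'I_n
}.

Section Graphs.
Variables (n : nat) (I : instance n).

Definition comm (u v : 'I_n) : bool := (u != v) && (adj I u v || adj I v u).

Fixpoint pweight (x : 'I_n) (p : seq 'I_n) : nat :=
  if p is y :: p' then wt I x y + pweight y p' else 0.
Definition weight (q : seq 'I_n) : nat :=
  if q is x :: p then pweight x p else 0.

Definition edges (q : seq 'I_n) : seq ('I_n * 'I_n) := zip q (behead q).

Definition st_path (q : seq 'I_n) : bool :=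
  if q is x :: p then
    [&& x == src I, path (adj I) x p, last x p == dst I & uniq q]
  else false.

Definition nedgesP : nat := (size (Pst I)).-1.
Definition edgeP (i : nat) : 'I_n * 'I_n :=
  (nth (src I) (Pst I) i, nth (src I) (Pst I) i.+1).

Definition avoids (q : seq 'I_n) (e : 'I_n * 'I_n) : bool := e \notin edges q.

Definition valid_instance : Prop :=
  (forall v, ~~ adj I v v) /\ st_path (Pst I) /\
  (forall q, st_path q -> weight (Pst I) <= weight q).

Definition weights_le (W : nat) : Prop := forall u v, adj I u v -> wt I u v <= W.

Definition undiam_le (D : nat) : Prop :=
  forall u v : 'I_n, exists p : seq 'I_n,
    [/\ path comm u p, last u p = v & size p <= D].

Definition follows (ptr : 'I_n -> option 'I_n) (q : seq 'I_n) : Prop :=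
  forall a b, (a, b) \in edges q -> ptr a = Some b.

Definition repl_dist (i : nat) (d : option nat) : Prop :=
  match d with
  | None => forall q, st_path q -> ~~ avoids q (edgeP i)
  | Some x => (exists q, [/\ st_path q, avoids q (edgeP i) & weight q = x]) /\
              (forall q, st_path q -> avoids q (edgeP i) -> x <= weight q)
  end.

Definition misses_P (q : seq 'I_n) : Prop :=
  exists2 i, i < nedgesP & avoids q (edgeP i).

Definition sisp_dist (d : option nat) : Prop :=
  match d with
  | None => forall q, st_path q -> ~ misses_P q
  | Some x => (exists q, [/\ st_path q, misses_P q & weight q = x]) /\
              (forall q, st_path q -> misses_P q -> x <= weight q)
  end.

End Graphs.

(* RPaths: each vertex outputs, for every edge index i of P_st, an optional
   claimed replacement weight (Some None = infinity) and a successor pointer. *)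
Definition out_RP (n : nat) : Type := nat -> option (option nat) * option 'I_n.

Definition RP_correct (n : nat) (I : instance n) (out : 'I_n -> out_RP n) : Prop :=
  forall i, i < nedgesP I ->
    (exists v, (out v i).1 != None) /\
    (forall v d, (out v i).1 = Some d ->
       repl_dist I i d /\
       (forall x, d = Some x -> exists q,
          [/\ st_path I q, avoids q (edgeP I i), weight I q = x &
              follows (fun a => (out a i).2) q])).

(* 2-SiSP: each vertex outputs an optional claimed weight and a successor. *)
Definition out_2S (n : nat) : Type := option (option nat) * option 'I_n.

Definition SiSP_correct (n : nat) (I : instance n) (out : 'I_n -> out_2S n) : Prop :=
  (exists v, (out v).1 != None) /\
  (forall v d, (out v).1 = Some d ->
     sisp_dist I d /\
     (forall x, d = Some x -> exists q,
        [/\ st_path I q, misses_P I q, weight I q = x &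
            follows (fun a => (out a).2) q])).

Record local_input (n L : nat) := LocalInput {
  li_id : 'I_n;
  li_out : 'I_n -> option nat;
  li_in : 'I_n -> option nat;
  li_s : 'I_n;
  li_t : 'I_n;
  li_pidx : option nat;
  li_psucc : option 'I_n;
  li_rand : L.-tuple bool
}.

Definition local_inp n L (I : instance n) (r : {ffun 'I_n -> L.-tuple bool})
  (v : 'I_n) : local_input n L :=
  LocalInput v
    (fun u => if adj I v u then Some (wt I v u) else None)
    (fun u => if adj I u v then Some (wt I u v) else None)
    (src I) (dst I)
    (if v \in Pst I then Some (index v (Pst I)) else None)
    (if v \in Pst I then
       (if index v (Pst I) < nedgesP I
        then Some (nth (src I) (Pst I) (index v (Pst I)).+1) else None)
     else None)
    (r v).

(* A (possibly randomized) CONGEST algorithm for n-node networks with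
   B-bit messages, L random bits per node, local state type S and output
   type O.  Local computation is arbitrary. In each round every node sends a
   B-bit message to each neighbour in the communication graph. *)
Record algo (n B L : nat) (S O : Type) := Algo {
  a_init : local_input n L -> S;
  a_send : S -> 'I_n -> B.-tuple bool;
  a_recv : S -> ('I_n -> option (B.-tuple bool)) -> S;
  a_out : S -> O
}.

Fixpoint run n B L S O (A : algo n B L S O) (I : instance n)
    (r : {ffun 'I_n -> L.-tuple bool}) (k : nat) : 'I_n -> S :=
  match k with
  | 0 => fun v => a_init A (local_inp I r v)
  | k'.+1 => let st := run A I r k' in
      fun v => a_recv A (st v)
                 (fun u => if comm I u v then Some (a_send A (st u) v) else None)
  end.

Definition outputs n B L S O (A : algo n B L S O) (I : instance n)
  (r : {ffun 'I_n -> L.-tuple bool}) (T : nat) : 'I_n -> O :=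
  fun v => a_out A (run A I r T v).

(* A solves the problem in T rounds with probability >= 2/3 on every
   instance of the class `cls` (probability over the private random bits). *)
Definition solves_whp n B L S (O : nat -> Type) (A : algo n B L S (O n))
  (correct : forall n, instance n -> ('I_n -> O n) -> Prop)
  (cls : instance n -> Prop) (T : nat) : Prop :=
  forall I : instance n, valid_instance I -> cls I ->
    exists G : {set {ffun 'I_n -> L.-tuple bool}},
      (forall r, r \in G -> correct n I (outputs A I r T)) /\
      2 * #|[set: {ffun 'I_n -> L.-tuple bool}]| <= 3 * #|G|.

(* Omega(n / log n) round lower bound, even on graphs of constant undirected
   diameter (and polynomial weights), for bandwidth B = Theta(log n). *)
Definition round_lower_bound (O : nat -> Type)
  (correct : forall n, instance n -> ('I_n -> O n) -> Prop) : Prop :=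
  exists D0 cW : nat, forall cB : nat, 0 < cB ->
  exists c N : nat, 0 < c /\
  forall n, N <= n ->
  forall (L T : nat) (S : Type) (A : algo n (cB * trunc_log 2 n) L S (O n)),
    solves_whp A correct
      (fun I => undiam_le I D0 /\ weights_le I (n ^ cW)) T ->
    n <= c * T * trunc_log 2 n.
Arguments round_lower_bound : clear implicits.

(* Main.v *)
Require Import Defs.
From mathcomp Require Import all_boot zify.
From Stdlib Require Import FunctionalExtensionality.
Set Implicit Arguments. Unset Strict Implicit. Unset Printing Implicit Defensive.

(* The bound is a reduction from set disjointness on k^2 points, k = Theta(n).
   Alice's set is a bipartite graph from P_st to k columns, Bob's set one from
   copies of the columns to k return nodes; leaving P_st at row i costs k - i
   and returning just behind row i' costs i', so simplicity of the path forces
   i' >= i, and a second path of weight at most k exists iff some cell (i, j)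
   lies in both sets. The two players are separated by 4k edges, so T rounds
   reveal O(k B T) bits.

   That disjointness needs Omega(k^2) bits is a corruption bound in the style
   of Razborov: draw V uniformly, then x inside V and y inside the complement
   of V. In a rectangle A x B whose slices below V are not exponentially
   small, all but few coordinates of V are unbiased for A, and likewise for B
   on the complement; flipping a doubly unbiased coordinate makes a disjoint
   pair intersect while losing only a constant factor. Hence a rectangle with
   large disjoint weight also has large intersecting weight. *)

(** * The corruption bound *)

Section Corruption.
Variable J : finType.
Implicit Types (A B : {set {set J}}) (V S x : {set J}).

Definition cnt A V : nat := \sum_(x in A | x \subset V) 1.
Definition cnt_in A V (i : J) : nat := \sum_(x in A | x \subset V) (i \in x).
Definition cnt_out A V (i : J) : nat := \sum_(x in A | x \subset V) (i \notin x).

Definition biased A V : {set J} :=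
  [set i in V | (8 * cnt_in A V i < cnt A V) || (8 * cnt_out A V i < cnt A V)].

Lemma cnt_in_out A V i : cnt_in A V i + cnt_out A V i = cnt A V.
Proof.
by rewrite /cnt -big_split /=; apply: eq_bigr => x _; case: (i \in x).
Qed.

Lemma cnt_outE A V i : cnt_out A V i = cnt A (V :\ i).
Proof.
rewrite /cnt_out /cnt big_mkcond [RHS]big_mkcond /=.
apply: eq_bigr => x _; rewrite subsetD1.
by case: (x \in A); case: (x \subset V) => //=; case: (i \in x).
Qed.

Lemma cnt_le A V : cnt A V <= 2 ^ #|V|.
Proof.
rewrite -card_powerset -sum1_card /cnt big_mkcond [leqRHS]big_mkcond /=.
by apply: leq_sum => x _; rewrite inE; case: (x \in A); case: (x \subset V).
Qed.

Lemma cnt_in_le A V i : cnt_in A V i <= 2 ^ #|V|.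
Proof. by apply: leq_trans (cnt_le A V); rewrite -(cnt_in_out A V i) leq_addr. Qed.

(** The sum factorises over coordinates: [1 + 3] on [D], [1 + 1] on the rest of [V], and 1 outside
    [V]. *)
Lemma sum_agreement (V D : {set J}) (v : pred J) : D \subset V ->
  \sum_(x : {set J} | x \subset V) \prod_(i in D) (if (i \in x) == v i then 3 else 1)
  = 2 ^ #|V| * 2 ^ #|D|.
Proof.
move=> DV.
pose F (b : bool) i := if i \in D then (if b == v i then 3 else 1) else 1.
have -> : 2 ^ #|V| * 2 ^ #|D| =
   \prod_(i : J) ((if i \in V then F true i else 0) + F false i).
  rewrite -(setIidPr DV) -!prod_nat_const.
  rewrite [X in X * _]big_mkcond [X in _ * X]big_mkcond -big_split /=.
  apply: eq_bigr => i _; rewrite /F in_setI.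
  have := subsetP DV i; case: (i \in V); case: (i \in D) => //= h; first by case: (v i).
  by have := h isT.
rewrite bigA_distr big_mkcond; apply: eq_bigr => x _.
case: ifPn => [xV|/subsetPn[i ix iV]].
  rewrite big_mkcond; apply: eq_bigr => i _; rewrite /F.
  by have := subsetP xV i; case: (i \in x) => [->|].
by rewrite (bigD1 i) //= ix (negbTE iV) mul0n.
Qed.

(* Markov: at most half of the members of A below V disagree with the majority
   values on more than j coordinates of D; the others weigh at least 27^j. *)
Lemma biased_small A V j : 4 * j <= #|biased A V| ->
  cnt A V * 27 ^ j <= 2 * 2 ^ #|V| * 16 ^ j.
Proof.
move=> hj.
have [D [DB cD]] : exists D : {set J}, D \subset biased A V /\ #|D| = 4 * j.
  exists [set i in take (4 * j) (enum (biased A V))]; split.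
    by apply/subsetP => i; rewrite inE => /mem_take; rewrite mem_enum.
  rewrite cardsE; rewrite (card_uniqP _) ?take_uniq ?enum_uniq //.
  by rewrite size_takel // -cardE.
have DV : D \subset V by apply: subset_trans DB _; apply/subsetP => i; rewrite inE => /andP[].
pose v i := ~~ (8 * cnt_in A V i < cnt A V).
pose dis x := \sum_(i in D) ((i \in x) != v i).
(* On a coordinate of [D] fewer than an eighth of the members disagree with [v], so [dis] averages
   at most [j / 2]. *)
have hdis : 8 * \sum_(x in A | x \subset V) dis x <= 4 * j * cnt A V.
  rewrite /dis exchange_big /= -cD -sum_nat_const big_distrr /=.
  apply: leq_sum => i /(subsetP DB); rewrite inE /v => /andP[_].
  case: ltnP => /= [h _|_ h]; apply: leq_trans (ltnW h); rewrite leq_mul2l /=;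
    by apply: leq_sum => x _; case: (i \in x).
have hM : cnt A V <= 2 * \sum_(x in A | x \subset V) (dis x <= j).
  have h0 : cnt A V * j.+1 <= \sum_(x in A | x \subset V) dis x
     + (\sum_(x in A | x \subset V) (dis x <= j)) * j.+1.
    rewrite /cnt !big_distrl -big_split /=; apply: leq_sum => x _.
    by rewrite mul1n; case: leqP => /= h; nia.
  nia.
have hA : (\sum_(x in A | x \subset V) (dis x <= j)) * 27 ^ j <= 2 ^ #|V| * 16 ^ j.
  have -> : 16 ^ j = 2 ^ #|D| by rewrite cD expnM.
  rewrite -(sum_agreement v DV) big_distrl /= big_mkcondl /=.
  apply: leq_sum => x _; case: ifP => // _.
  have [h|//] := leqP (dis x) j; rewrite mul1n.
  have -> : \prod_(i in D) (if (i \in x) == v i then 3 else 1)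
     = 3 ^ (\sum_(i in D) ((i \in x) == v i)).
    by rewrite (expn_sum 3); apply: eq_bigr => i _; case: eqP.
  rewrite -(expnM 3 3) leq_exp2l //.
  have : dis x + \sum_(i in D) ((i \in x) == v i) = #|D|.
    by rewrite -big_split -sum1_card /=; apply: eq_bigr => i _; case: eqP.
  by rewrite cD; lia.
rewrite -mulnA.
apply: leq_trans (_ : 2 * ((\sum_(x in A | x \subset V) (dis x <= j)) * 27 ^ j) <= _);
  last by rewrite leq_mul2l.
by rewrite mulnA leq_mul2r hM orbT.
Qed.

(** Up to the factor [4 ^ #|J|], an expectation over random disjoint pairs: every [V] admits the
    same number [2 ^ #|J|] of pairs. *)
Definition disj_sum (F : {set J} -> {set J} -> nat) : nat :=
  \sum_(V : {set J}) \sum_(x : {set J} | x \subset V)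
    \sum_(y : {set J} | y \subset ~: V) F x y.

(** Here [i] is the only common point of [x] and [y]. *)
Definition meet_sum (F : {set J} -> {set J} -> nat) : nat :=
  \sum_(V : {set J}) \sum_(i in ~: V)
    \sum_(x : {set J} | (x \subset i |: V) && (i \in x))
      \sum_(y : {set J} | (y \subset ~: V) && (i \in y)) F x y.

Definition rect A B (x y : {set J}) : nat := (x \in A) && (y \in B).

Lemma sum_rect A B (P Q : pred {set J}) :
  \sum_(x | P x) \sum_(y | Q y) rect A B x y
  = (\sum_(x in A | P x) 1) * (\sum_(y in B | Q y) 1).
Proof.
rewrite big_distrl /= big_mkcond [RHS]big_mkcond /=; apply: eq_bigr => x _.
rewrite /rect; case: (P x); rewrite ?andbT ?andbF //.
rewrite mul1n big_mkcond; case: (x \in A) => /=; last by rewrite big1 // => y _; case: ifP.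
by rewrite [RHS]big_mkcond; apply: eq_bigr => y _; case: (Q y); case: (y \in B).
Qed.

Lemma disj_sum_rect A B : disj_sum (rect A B) = \sum_(V : {set J}) cnt A V * cnt B (~: V).
Proof. by apply: eq_bigr => V _; rewrite sum_rect. Qed.

Lemma cnt_inE A V i : \sum_(x in A | (x \subset V) && (i \in x)) 1 = cnt_in A V i.
Proof.
rewrite /cnt_in big_mkcond [RHS]big_mkcond; apply: eq_bigr => x _.
by case: (x \in A); case: (x \subset V); case: (i \in x).
Qed.

Lemma meet_sum_rect A B : meet_sum (rect A B) =
  \sum_(V : {set J}) \sum_(i in ~: V) cnt_in A (i |: V) i * cnt_in B (~: V) i.
Proof.
apply: eq_bigr => V _; apply: eq_bigr => i _.
by rewrite (sum_rect A B) !cnt_inE.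
Qed.

(** Both sides enumerate the hypercube edges, by lower endpoint on the left and by upper endpoint on
    the right. *)
Lemma reindex_setU1 (F : {set J} -> J -> nat) :
  \sum_(V : {set J}) \sum_(i in ~: V) F (i |: V) i = \sum_(V : {set J}) \sum_(i in V) F V i.
Proof.
rewrite !pair_big_dep /=.
rewrite [RHS](reindex_onto (fun p : {set J} * J => (p.2 |: p.1, p.2))
                    (fun p => (p.1 :\ p.2, p.2))) /=; last first.
  by case=> V i /= iV; rewrite setD1K.
apply: eq_bigl => -[V i] /=; rewrite !inE eqxx /= xpair_eqE eqxx andbT.
apply/idP/eqP => [iV|<-]; last by rewrite setD11.
by apply/setP => u; rewrite !inE; case: eqP => [->|] //=; rewrite (negbTE iV).
Qed.

(** Either fewer than [4 * j] coordinates are biased, which gives the first term, or [biased_small]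
    makes [cnt A V] tiny and trivial bounds on the other factors give the second. *)
Lemma weight_biased A B V j :
  cnt A V * cnt B (~: V) * #|biased A V| * 27 ^ j
  <= 4 * j * (cnt A V * cnt B (~: V)) * 27 ^ j + #|J| * 2 * 2 ^ #|J| * 16 ^ j.
Proof.
have [h|h] := leqP (4 * j) #|biased A V|; last first.
  by apply: leq_trans (leq_addr _ _); rewrite leq_mul2r mulnC leq_mul2r (ltnW h) !orbT.
apply: leq_trans (leq_addl _ _).
have a := biased_small h; have b := cnt_le B (~: V); have c := max_card (mem (biased A V)).
have -> : 2 ^ #|J| = 2 ^ #|V| * 2 ^ #|~: V| by rewrite -expnD cardsC.
have -> : cnt A V * cnt B (~: V) * #|biased A V| * 27 ^ j =
  (cnt A V * 27 ^ j) * cnt B (~: V) * #|biased A V| by lia.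
apply: leq_trans (leq_mul (leq_mul a b) c) _; by lia.
Qed.

Lemma unbiasedP A V i : i \in V -> i \notin biased A V ->
  cnt A V <= 8 * cnt_in A V i /\ cnt A V <= 8 * cnt_out A V i.
Proof. by move=> iV; rewrite inE iV /= negb_or -!leqNgt => /andP[]. Qed.

Lemma sum_biased A V : \sum_(i in V) (i \in biased A V) = #|biased A V|.
Proof.
rewrite -sum1_card big_mkcond [RHS]big_mkcond; apply: eq_bigr => i _.
by rewrite !inE; case: (i \in V) => //=; case: (_ || _).
Qed.

Lemma setCU1 V i : ~: (i |: V) = ~: V :\ i.
Proof. by apply/setP => u; rewrite !inE negb_or. Qed.

(** [w] weighs a vertex of the hypercube and [edge_sum] its edges, with [A] read at the lower end
    and [B] at the upper; [loss] pays the full weight of [V] for each biased coordinate. *)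
Let w A B V := cnt A V * cnt B (~: V).
Let edge_sum A B := \sum_(V : {set J}) \sum_(i in ~: V) cnt A V * cnt B (~: (i |: V)).
Let loss A B := \sum_(V : {set J}) w A B V * (#|biased A V| + #|biased B (~: V)|).

(** Passing from a vertex to an incident edge changes one of the two factors and costs at most 8 at
    an unbiased coordinate. Each edge is met from both ends, hence 16. *)
Lemma disj_sum_edge A B :
  #|J| * disj_sum (rect A B) <= 16 * edge_sum A B + loss A B.
Proof.
rewrite disj_sum_rect.
have -> : 16 * edge_sum A B = 8 * edge_sum A B +
   8 * \sum_(V : {set J}) \sum_(i in V) cnt A (V :\ i) * cnt B (~: V).
  rewrite -(reindex_setU1 (fun V i => cnt A (V :\ i) * cnt B (~: V))) -mulnDr.
  have -> : \sum_(V : {set J}) \sum_(i in ~: V) cnt A ((i |: V) :\ i) * cnt B (~: (i |: V))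
     = edge_sum A B; last by lia.
  apply: eq_bigr => V _; apply: eq_bigr => i; rewrite inE => iV.
  congr (cnt A _ * _); apply/setP => u; rewrite !inE.
  by case: eqP => [->|] //=; rewrite (negbTE iV).
rewrite !big_distrr -!big_split /=; apply: leq_sum => V _.
have -> : #|J| * (cnt A V * cnt B (~: V)) =
  \sum_(i in V) w A B V + \sum_(i in ~: V) w A B V.
  by rewrite !sum_nat_const -mulnDl cardsC.
have hA : \sum_(i in V) w A B V <=
   8 * (\sum_(i in V) cnt A (V :\ i) * cnt B (~: V)) + w A B V * #|biased A V|.
  rewrite -sum_biased !big_distrr -big_split /=; apply: leq_sum => i iV.
  case: (boolP (i \in biased A V)) => hb; first by rewrite muln1 leq_addl.
  have [_] := unbiasedP iV hb; rewrite cnt_outE /w muln0 addn0 mulnA => h.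
  by rewrite leq_mul2r h orbT.
have hB : \sum_(i in ~: V) w A B V <=
   8 * (\sum_(i in ~: V) cnt A V * cnt B (~: (i |: V))) + w A B V * #|biased B (~: V)|.
  rewrite -sum_biased !big_distrr -big_split /=; apply: leq_sum => i iV.
  case: (boolP (i \in biased B (~: V))) => hb; first by rewrite muln1 leq_addl.
  have [_] := unbiasedP iV hb; rewrite cnt_outE setCU1 /w muln0 addn0 mulnCA => h.
  by rewrite leq_mul2l h orbT.
by rewrite mulnDr; lia.
Qed.

(* Both endpoints of a hypercube edge V -- i |: V dominate the mixed weight
   cnt A V * cnt B (~: (i |: V)), so an edge that is biased for A is charged to
   its upper endpoint and one that is biased for B to its lower endpoint. *)
Lemma edge_sum_meet A B :
  edge_sum A B <= 64 * meet_sum (rect A B) + loss A B.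
Proof.
rewrite meet_sum_rect.
have -> : loss A B = \sum_(V : {set J}) \sum_(i in ~: V)
  (w A B (i |: V) * (i \in biased A (i |: V)) + w A B V * (i \in biased B (~: V))).
  under [RHS]eq_bigr => V _ do rewrite big_split /=.
  rewrite big_split /= (reindex_setU1 (fun V i => w A B V * (i \in biased A V))) -big_split.
  by apply: eq_bigr => V _; rewrite -!big_distrr /= !sum_biased mulnDr.
rewrite big_distrr -big_split; apply: leq_sum => V _ /=.
rewrite big_distrr -big_split; apply: leq_sum => i iV /=.
have aA : cnt A V <= cnt A (i |: V).
  by rewrite -(cnt_in_out A (i |: V) i) cnt_outE setU1K ?leq_addl //; rewrite inE in iV.
have bB : cnt B (~: (i |: V)) <= cnt B (~: V).
  by rewrite setCU1 -cnt_outE -(cnt_in_out B (~: V) i) leq_addl.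
case: (boolP (i \in biased A (i |: V))) => hA.
  apply: leq_trans (leq_addl _ _); apply: leq_trans (leq_addr _ _).
  by rewrite muln1 leq_mul2r aA orbT.
case: (boolP (i \in biased B (~: V))) => hB.
  apply: leq_trans (leq_addl _ _); apply: leq_trans (leq_addl _ _).
  by rewrite muln1 leq_mul2l bB orbT.
rewrite !muln0 !addn0.
have [h1 _] := unbiasedP (setU11 i V) hA.
have [h2 _] := unbiasedP iV hB.
have := leq_mul (leq_trans aA h1) (leq_trans bB h2); by lia.
Qed.

(** Chaining the two comparisons leaves [17 * loss], whose main part is [136 * j] times the disjoint
    weight; [272 * j <= #|J|] absorbs it into half of the left side. *)
Lemma corruption A B j : 272 * j <= #|J| ->
  #|J| * disj_sum (rect A B) * 27 ^ j <=
  2048 * meet_sum (rect A B) * 27 ^ j + 136 * #|J| * 4 ^ #|J| * 16 ^ j.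
Proof.
move=> hj.
have hL : loss A B * 27 ^ j <=
   8 * j * disj_sum (rect A B) * 27 ^ j + 4 * #|J| * 4 ^ #|J| * 16 ^ j.
  rewrite disj_sum_rect.
  have -> : 4 * #|J| * 4 ^ #|J| * 16 ^ j =
     \sum_(V : {set J}) 2 * (#|J| * 2 * 2 ^ #|J| * 16 ^ j).
    have -> : 4 ^ #|J| = #|{set J}| * 2 ^ #|J|.
      by rewrite -(cardsT {set J}) -powersetT card_powerset cardsT (expnMn 2 2).
    by rewrite sum_nat_const (eq_card (B := {set J})) //; lia.
  rewrite /loss big_distrl big_distrr big_distrl -big_split; apply: leq_sum => V _ /=.
  have a := weight_biased A B V j.
  have b := weight_biased B A (~: V) j; rewrite setCK in b.
  rewrite (mulnC (cnt B _)) in b.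
  rewrite /w mulnDr mulnDl; apply: leq_trans (leq_add a b) _; clear.
  by move: (cnt A V * _) (2 ^ #|J|) => p q; move: #|J| => N; lia.
have h1 := disj_sum_edge A B; have h2 := edge_sum_meet A B.
have h3 : #|J| * disj_sum (rect A B) <= 1024 * meet_sum (rect A B) + 17 * loss A B by lia.
have h4 := leq_mul h3 (leqnn (27 ^ j)).
have h5 : 272 * j * (disj_sum (rect A B) * 27 ^ j) <= #|J| * (disj_sum (rect A B) * 27 ^ j).
  by rewrite leq_mul2r hj orbT.
lia.
Qed.
End Corruption.

(** * Disjointness with bounded error *)

Section Amplification.
Variable J : finType.
Implicit Types (F G : {set J} -> {set J} -> nat) (x y V : {set J}).

Lemma disjoint_split V x y : x \subset V -> y \subset ~: V -> [disjoint x & y].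
Proof. by move=> xV yV; apply: disjointWl xV _; rewrite disjoint_sym disjoints_subset. Qed.

Lemma disj_sum_mono F G : (forall x y, [disjoint x & y] -> F x y <= G x y) ->
  disj_sum F <= disj_sum G.
Proof.
move=> h; apply: leq_sum => V _; apply: leq_sum => x xV; apply: leq_sum => y yV.
exact: h (disjoint_split xV yV).
Qed.

Lemma meet_sum_mono F G : (forall x y, ~~ [disjoint x & y] -> F x y <= G x y) ->
  meet_sum F <= meet_sum G.
Proof.
move=> h; apply: leq_sum => V _; apply: leq_sum => i _.
apply: leq_sum => x /andP[_ ix]; apply: leq_sum => y /andP[_ iy]; apply: h.
by apply/pred0Pn; exists i; rewrite /= ix.
Qed.

Lemma disj_sumZ c F : disj_sum (fun x y => c * F x y) = c * disj_sum F.
Proof.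
rewrite big_distrr; apply: eq_bigr => V _.
by rewrite big_distrr; apply: eq_bigr => x _; rewrite big_distrr.
Qed.

Lemma meet_sumZ c F : meet_sum (fun x y => c * F x y) = c * meet_sum F.
Proof.
rewrite big_distrr; apply: eq_bigr => V _; rewrite big_distrr; apply: eq_bigr => i _.
by rewrite big_distrr; apply: eq_bigr => x _; rewrite big_distrr.
Qed.

Lemma disj_sum_sum (I : finType) (F : I -> {set J} -> {set J} -> nat) :
  disj_sum (fun x y => \sum_i F i x y) = \sum_i disj_sum (F i).
Proof.
rewrite [RHS]exchange_big; apply: eq_bigr => V _.
rewrite [RHS]exchange_big; apply: eq_bigr => x _.
by rewrite [RHS]exchange_big.
Qed.

Lemma meet_sum_sum (I : finType) (F : I -> {set J} -> {set J} -> nat) :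
  meet_sum (fun x y => \sum_i F i x y) = \sum_i meet_sum (F i).
Proof.
rewrite [RHS]exchange_big; apply: eq_bigr => V _.
rewrite [RHS]exchange_big; apply: eq_bigr => i _.
rewrite [RHS]exchange_big; apply: eq_bigr => x _.
by rewrite [RHS]exchange_big.
Qed.

Lemma disj_sum_eq F G : (forall x y, F x y = G x y) -> disj_sum F = disj_sum G.
Proof. by move=> h; apply/eqP; rewrite eqn_leq !disj_sum_mono // => x y _; rewrite h. Qed.

Lemma meet_sum_eq F G : (forall x y, F x y = G x y) -> meet_sum F = meet_sum G.
Proof. by move=> h; apply/eqP; rewrite eqn_leq !meet_sum_mono // => x y _; rewrite h. Qed.

Lemma rectT x y : 1 = rect [set: {set J}] [set: {set J}] x y.
Proof. by rewrite /rect !inE. Qed.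

Lemma cntT V : cnt [set: {set J}] V = 2 ^ #|V|.
Proof.
rewrite -card_powerset -sum1_card /cnt; apply: eq_bigl => x.
by rewrite !inE.
Qed.

Lemma sum_nat_constT (T : finType) c : \sum_(t : T) c = #|T| * c.
Proof. by rewrite sum_nat_const; congr (_ * _); apply: eq_card. Qed.

Lemma sum_set_const c : \sum_(V : {set J}) c = 2 ^ #|J| * c.
Proof.
by rewrite sum_nat_constT -[#|J|]cardsT -card_powerset powersetT cardsT.
Qed.

Lemma disj_sum1 : disj_sum (fun _ _ : {set J} => 1) = 4 ^ #|J|.
Proof.
rewrite (disj_sum_eq rectT) disj_sum_rect.
under eq_bigr => V _ do rewrite !cntT -expnD cardsC.
by rewrite sum_set_const (expnMn 2 2).
Qed.

Lemma meet_sum1 : meet_sum (fun _ _ : {set J} => 1) <= 2 * #|J| * 4 ^ #|J|.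
Proof.
rewrite (meet_sum_eq rectT) meet_sum_rect.
have -> : 2 * #|J| * 4 ^ #|J| = \sum_(V : {set J}) \sum_(i : J) 2 * 2 ^ #|J|.
  rewrite sum_set_const sum_nat_constT.
  by rewrite (expnMn 2 2); move: #|J| => N; lia.
apply: leq_sum => V _; rewrite big_mkcond; apply: leq_sum => i _; case: ifP => // iV.
apply: leq_trans (leq_mul (cnt_in_le _ _ _) (cnt_in_le _ _ _)) _.
rewrite cardsU1 -in_setC iV -!expnD -expnS leq_exp2l //.
by rewrite -(cardsC V); move: #|V| #|~: V| => a b; lia.
Qed.

(* Rejecting as soon as one of 13 independent runs rejects turns the ratio 2
   between the acceptance probabilities on disjoint and on intersecting pairs
   into 2^13, which beats the constant 2048 of the corruption bound. *)
Lemma disjointness_bound (Tr Om : finType)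
  (tr : Om -> {set J} -> {set J} -> Tr) (acc : Om -> {set J} -> {set J} -> bool) j :
  (forall w x y x' y', tr w x y = tr w x' y' -> tr w x y' = tr w x y) ->
  (forall w x y x' y', tr w x y = tr w x' y' ->
     acc w x y -> acc w x' y' -> acc w x y') ->
  (forall x y, [disjoint x & y] -> 2 * #|Om| <= 3 * #|[set w | acc w x y]|) ->
  (forall x y, ~~ [disjoint x & y] -> 3 * #|[set w | acc w x y]| <= #|Om|) ->
  0 < #|Om| -> 0 < #|J| -> 272 * j <= #|J| ->
  2 ^ 12 * 27 ^ j <= 3 ^ 13 * 136 * (#|Tr| ^ 13 * 16 ^ j).
Proof.
have -> : 2 ^ 12 = 4096 by [].
move=> trP accP hdis hmeet Om0 J0 hj.
pose accK (r : {ffun 'I_13 -> Om}) x y : bool := [forall a, acc (r a) x y].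
pose trK (r : {ffun 'I_13 -> Om}) x y : {ffun 'I_13 -> Tr} := [ffun a => tr (r a) x y].
pose A r t := [set x | [exists y, accK r x y && (trK r x y == t)]].
pose B r t := [set y | [exists x, accK r x y && (trK r x y == t)]].
(* By cut and paste, the accepted pairs with transcript [t] form a rectangle, so acceptance is a
   disjoint sum of rectangles. *)
have accKE r x y : accK r x y = \sum_t rect (A r t) (B r t) x y :> nat.
  have E t : rect (A r t) (B r t) x y = accK r x y && (trK r x y == t).
    rewrite /rect !inE; congr (nat_of_bool _); apply/andP/andP.
      case=> /existsP[y' /andP[/forallP a1 /eqP t1]].
      case/existsP=> x' /andP[/forallP a2 /eqP t2].
      have tt a : tr (r a) x y' = tr (r a) x' y.
        by have /ffunP/(_ a) := etrans t1 (esym t2); rewrite !ffunE.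
      split; first by apply/forallP => a; apply: accP (tt a) _ _.
      by rewrite -t1; apply/eqP/ffunP => a; rewrite !ffunE (trP _ _ _ _ _ (tt a)).
    by case=> a t1; split; apply/existsP; [exists y | exists x]; rewrite a.
  under eq_bigr => t _ do rewrite E.
  rewrite (bigD1 (trK r x y)) //= eqxx andbT big1 ?addn0 // => t.
  by rewrite eq_sym => /negbTE->; rewrite andbF.
have sumK x y : \sum_r accK r x y = #|[set w | acc w x y]| ^ 13.
  rewrite -[13 in RHS]card_ord -prod_nat_const.
  under [RHS]eq_bigr => a _ do rewrite -sum1_card big_mkcond.
  rewrite bigA_distr_bigA; apply: eq_bigr => r _ /=.
  case: (boolP (accK r x y)) => [/forallP h|/forallPn[a h]].
    by rewrite big1 // => a _; rewrite inE h.
  by rewrite (bigD1 a) //= inE (negbTE h).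
have cardK (T : finType) : #|T| ^ 13 = #|{ffun 'I_13 -> T}| by rewrite card_ffun card_ord.
set M := #|Om| ^ 13; set N := #|J| in hj J0 *.
have corr r : N * disj_sum (accK r) * 27 ^ j <=
   2048 * meet_sum (accK r) * 27 ^ j + #|Tr| ^ 13 * (136 * N * 4 ^ N * 16 ^ j).
  rewrite (disj_sum_eq (accKE r)) (meet_sum_eq (accKE r)) disj_sum_sum meet_sum_sum.
  rewrite cardK -(sum_nat_constT {ffun 'I_13 -> Tr}) !big_distrr !big_distrl -big_split.
  by apply: leq_sum => t _; apply: corruption.
have total : N * (\sum_r disj_sum (accK r)) * 27 ^ j <=
   2048 * (\sum_r meet_sum (accK r)) * 27 ^ j + M * (#|Tr| ^ 13 * (136 * N * 4 ^ N * 16 ^ j)).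
  rewrite /M cardK -(sum_nat_constT {ffun 'I_13 -> Om}).
  by rewrite !big_distrr !big_distrl -big_split; apply: leq_sum => r _.
rewrite -disj_sum_sum -meet_sum_sum (disj_sum_eq sumK) (meet_sum_eq sumK) in total.
have lo : 2 ^ 13 * M * 4 ^ N <= 3 ^ 13 * disj_sum (fun x y => #|[set w | acc w x y]| ^ 13).
  rewrite -disj_sum1 -!disj_sumZ; apply: disj_sum_mono => x y xy.
  by rewrite muln1 -!expnMn leq_exp2r // hdis.
have hi : 3 ^ 13 * meet_sum (fun x y => #|[set w | acc w x y]| ^ 13) <= M * (2 * N * 4 ^ N).
  apply: leq_trans (leq_mul (leqnn M) meet_sum1).
  rewrite -!meet_sumZ; apply: meet_sum_mono => x y xy.
  by rewrite muln1 -!expnMn leq_exp2r // hmeet.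
have P0 : 0 < N * 4 ^ N * M by rewrite !muln_gt0 J0 !expn_gt0 Om0.
(* After scaling by [3 ^ 13], the disjoint side carries [2 ^ 13] and the intersecting side at most
   [2048 * 2 = 2 ^ 12]; the error term has to cover the difference. *)
have E13 : 2 ^ 13 = 2 * 4096 by [].
rewrite E13 in lo; rewrite -(leq_pmul2l P0).
move: total lo hi; move: (disj_sum _) (meet_sum _) (27 ^ j) (16 ^ j) (4 ^ N) (3 ^ 13) (#|Tr| ^ 13).
clearbody M N; clear; move=> D U a b q t T h1 h2 h3.
have h1' := leq_mul (leqnn t) h1.
have h2' := leq_mul h2 (leqnn (N * a)).
have h3' := leq_mul h3 (leqnn (2048 * a)).
lia.
Qed.
End Amplification.

(** * Simulating a CONGEST algorithm across a cut *)

Lemma comm_sym n (I : instance n) u v : comm I u v = comm I v u.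
Proof. by rewrite /comm eq_sym orbC. Qed.

Lemma comm_local n L (I I' : instance n) (r : {ffun 'I_n -> L.-tuple bool}) v :
  local_inp I r v = local_inp I' r v -> forall u, comm I u v = comm I' u v.
Proof.
move=> h u; rewrite /comm.
have := f_equal (fun l => li_out l u) h; have := f_equal (fun l => li_in l u) h.
by rewrite /=; do 4 case: (adj _ _ _).
Qed.

Section Simulation.
Variables (n B L T : nat) (S O X : Type) (A : algo n B L S O).
Variables (inst : X -> X -> instance n) (alice : pred 'I_n).
Variables (c : nat) (cut : 'I_c -> 'I_n * 'I_n).
Hypothesis alice_input : forall x y y' r v, alice v ->
  local_inp (inst x y) r v = local_inp (inst x y') r v :> local_input n L.
Hypothesis bob_input : forall x x' y r v, ~~ alice v ->
  local_inp (inst x y) r v = local_inp (inst x' y) r v :> local_input n L.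
Hypothesis cut_alice : forall e, alice (cut e).1.
Hypothesis cut_bob : forall e, ~~ alice (cut e).2.
Hypothesis cut_cover : forall x y u v, comm (inst x y) u v -> alice u -> ~~ alice v ->
  exists e, cut e = (u, v).

Variable r : {ffun 'I_n -> L.-tuple bool}.

Definition transcript x y : {ffun 'I_T * 'I_c -> B.-tuple bool * B.-tuple bool} :=
  [ffun p : 'I_T * 'I_c => let st := run A (inst x y) r p.1 in
     (a_send A (st (cut p.2).1) (cut p.2).2, a_send A (st (cut p.2).2) (cut p.2).1)].

(** Cut and paste, by induction on rounds: messages from the same side agree because the sending
    states do, and messages across the cut agree because the transcripts do. *)
Lemma run_cut x y x' y' : transcript x y = transcript x' y' ->
  forall k, k <= T -> forall v,
  run A (inst x y') r k v =
    if alice v then run A (inst x y) r k v else run A (inst x' y') r k v.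
Proof.
move=> htr; elim=> [_|k IH kT] v /=.
  case: ifPn => hv; first by rewrite (alice_input x y' y r hv).
  by rewrite (bob_input x x' y' r hv).
have {}IH := IH (ltnW kT).
have msg e : a_send A (run A (inst x y) r k (cut e).1) (cut e).2
           = a_send A (run A (inst x' y') r k (cut e).1) (cut e).2 /\
    a_send A (run A (inst x y) r k (cut e).2) (cut e).1
           = a_send A (run A (inst x' y') r k (cut e).2) (cut e).1.
  by have /ffunP/(_ (Ordinal kT, e)) := htr; rewrite !ffunE /= => -[].
rewrite IH; case: ifPn => hv; congr (a_recv A _ _);
  apply: functional_extensionality => u; rewrite IH.
- have -> := comm_local (alice_input x y' y r hv).
  case: ifPn => // huv; case: ifPn => // hu.
  rewrite comm_sym in huv; have [e he] := cut_cover huv hv hu.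
  by have := (msg e).2; rewrite he /= => ->.
- have -> := comm_local (bob_input x x' y' r hv).
  case: ifPn => // huv; case: ifPn => // hu.
  have [e he] := cut_cover huv hu hv.
  by have := (msg e).1; rewrite he /= => ->.
Qed.

Lemma transcript_cut x y x' y' : transcript x y = transcript x' y' ->
  transcript x y' = transcript x y.
Proof.
move=> htr; apply/ffunP => -[t e].
have ht := ltnW (ltn_ord t).
have /ffunP/(_ (t, e)) := htr; rewrite !ffunE /= => -[_ h2].
by rewrite !(run_cut htr ht) cut_alice (negbTE (cut_bob e)) h2.
Qed.

(** A conjunction of local tests splits into Alice's vertices, which behave as in the first run, and
    Bob's, which behave as in the second. *)
Lemma accept_cut (P : pred O) x y x' y' : transcript x y = transcript x' y' ->
  [forall v, P (outputs A (inst x y) r T v)] ->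
  [forall v, P (outputs A (inst x' y') r T v)] ->
  [forall v, P (outputs A (inst x y') r T v)].
Proof.
move=> htr /forallP h1 /forallP h2; apply/forallP => v.
rewrite /outputs (run_cut htr (leqnn T)); case: ifP => _; [exact: h1 | exact: h2].
Qed.
End Simulation.

(** * The gadget graph *)

(** The threshold question that a correct output of either problem answers. *)
Definition short_detour n (I : instance n) (b : nat) : Prop :=
  exists q, [/\ st_path I q, misses_P I q & weight I q <= b].

Lemma mem_edgesP n (d : 'I_n) q e :
  reflect (exists2 m, m.+1 < size q & e = (nth d q m, nth d q m.+1)) (e \in edges q).
Proof.
have sz : size (edges q) = (size q).-1.
  by rewrite /edges size_zip size_behead; apply/minn_idPr/leq_pred.
have nthE m : m.+1 < size q -> nth (d, d) (edges q) m = (nth d q m, nth d q m.+1).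
  by move=> hm; rewrite nth_zip_cond -/(edges q) sz ifT ?nth_behead //; lia.
apply: (iffP (nthP (d, d))); rewrite ?sz => -[m hm he]; exists m; rewrite ?sz; try lia.
  by rewrite -he nthE //; lia.
by rewrite nthE.
Qed.

Section Gadget.
Variables (n k : nat).
Hypothesis k_gt0 : 0 < k.
Hypothesis n_ge : 4 * k + 2 <= n.

Lemma n_gt0 : 0 < n. Proof. lia. Qed.
Definition vtx (a : nat) : 'I_n := insubd (Ordinal n_gt0) a.

Lemma vtxK a : a < n -> vtx a = a :> nat.
Proof. by move=> h; rewrite val_insubd h. Qed.

Lemma valK_vtx (v : 'I_n) : vtx v = v.
Proof. by apply: ord_inj; rewrite vtxK. Qed.

(* Vertex codes: 0..k is the path P_st; k+1+j and 2k+1+j are the two copies of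
   column j; 3k+1+i is the return node of row i; 4k+1 is a sink adjacent to
   every vertex, which makes the undirected diameter 2; the rest is padding. *)
Definition gadj (X Y : rel nat) (u v : nat) : bool :=
  [|| (v == 4 * k + 1) && (u != 4 * k + 1),
      (u < k) && (v == u.+1),
      [&& u < k, k + 1 <= v < 2 * k + 1 & X u (v - (k + 1))],
      (k + 1 <= u < 2 * k + 1) && (v == u + k),
      [&& 2 * k + 1 <= u < 3 * k + 1, 3 * k + 1 <= v < 4 * k + 1
        & Y (v - (3 * k + 1)) (u - (2 * k + 1))]
    | (3 * k + 1 <= u < 4 * k + 1) && (v == u - 3 * k)].

Definition gwt (u v : nat) : nat :=
  if (u < k) && (k + 1 <= v < 2 * k + 1) then k - u
  else if (3 * k + 1 <= u < 4 * k + 1) && (v <= k) then u - (3 * k + 1) else 0.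

Definition gadget (X Y : rel nat) : instance n :=
  Instance (fun u v => gadj X Y u v) (fun u v => gwt u v) (vtx 0) (vtx k)
    (map vtx (iota 0 k.+1)).

(** Alice owns the spine, the first column copies, the sink and the padding, so [X]-edges stay on
    her side and [Y]-edges on Bob's. *)
Definition alice (v : nat) : bool := ~~ (2 * k + 1 <= v < 4 * k + 1).

Lemma gadget_alice L X Y Y' (r : {ffun 'I_n -> L.-tuple bool}) (v : 'I_n) :
  alice v -> local_inp (gadget X Y) r v = local_inp (gadget X Y') r v.
Proof.
rewrite /alice => hv; congr LocalInput; apply: functional_extensionality => u /=;
  congr (if _ then _ else _); rewrite /gadj; congr [|| _, _, _, _, _ | _].
  by case: (boolP (2 * k + 1 <= v < 3 * k + 1)) => //=; lia.
by case: (boolP (3 * k + 1 <= v < 4 * k + 1)) => //=; rewrite ?andbF //; lia.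
Qed.

Lemma gadget_bob L X X' Y (r : {ffun 'I_n -> L.-tuple bool}) (v : 'I_n) :
  ~~ alice v -> local_inp (gadget X Y) r v = local_inp (gadget X' Y) r v.
Proof.
rewrite /alice negbK => hv; congr LocalInput; apply: functional_extensionality => u /=;
  congr (if _ then _ else _); rewrite /gadj; congr [|| _, _, _, _, _ | _].
  by case: (boolP (v < k)) => //=; lia.
by case: (boolP (k + 1 <= v < 2 * k + 1)) => //=; rewrite ?andbF //; lia.
Qed.

(* Every vertex of Bob has exactly two cut edges: one to the sink (e < 2k) and
   one to its fixed neighbour on Alice's side. *)
Definition cut (e : 'I_(4 * k)) : 'I_n * 'I_n :=
  let m := if e < 2 * k then nat_of_ord e else e - 2 * k in
  (vtx (if e < 2 * k then 4 * k + 1 else if m < k then k + 1 + m else m - k + 1),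
   vtx (2 * k + 1 + m)).

Lemma cut_alice e : alice (cut e).1.
Proof.
have he := ltn_ord e; rewrite /cut /= vtxK /alice; last by (repeat case: ifP); lia.
by (repeat case: ifP); lia.
Qed.

Lemma cut_bob e : ~~ alice (cut e).2.
Proof.
have he := ltn_ord e; rewrite /cut /= vtxK /alice; last by case: ifP; lia.
by case: ifP; lia.
Qed.

Lemma cut_cover X Y (u v : 'I_n) : comm (gadget X Y) u v -> alice u -> ~~ alice v ->
  exists e, cut e = (u, v).
Proof.
rewrite /comm /= => /andP[_ h] ha; rewrite /alice negbK => hb.
have [hu|hu] : u = 4 * k + 1 :> nat \/
   u = (if v < 3 * k + 1 then v - k else v - 3 * k) :> nat.
  move: h ha; rewrite /alice /gadj.
  by case/orP=> [|] /or4P[|||/or3P[||]]; case: ifP; lia.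
- have he : v - (2 * k + 1) < 4 * k by lia.
  exists (Ordinal he); rewrite /cut /=.
  by congr pair; apply: ord_inj; rewrite vtxK; (repeat case: ifP); lia.
(* [v - 1] is [2 * k + (v - (2 * k + 1))], the slot of [v] in the second half of the cut. *)
have he : v - 1 < 4 * k by lia.
exists (Ordinal he); rewrite /cut /=.
by congr pair; apply: ord_inj; rewrite vtxK; move: hu; (repeat case: ifP); lia.
Qed.

Lemma gadget_undiam X Y : undiam_le (gadget X Y) 2.
Proof.
move=> u v; have hb : 4 * k + 1 < n by lia.
have hub w : w != vtx (4 * k + 1) -> comm (gadget X Y) w (vtx (4 * k + 1)).
  move=> hw; rewrite /comm hw /= /gadj vtxK // eqxx /=.
  suff -> : w != 4 * k + 1 :> nat by [].
  by apply: contra hw => /eqP hw; apply/eqP/ord_inj; rewrite /= vtxK.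
have hub' w : w != vtx (4 * k + 1) -> comm (gadget X Y) (vtx (4 * k + 1)) w.
  by move=> hw; rewrite /comm eq_sym orbC -/(comm (gadget X Y) w _) hub.
have [->|uv] := eqVneq u v; first by exists [::].
have [hu|hu] := eqVneq u (vtx (4 * k + 1)).
  by exists [:: v]; split; rewrite //= andbT hu hub' // -hu eq_sym.
have [hv|hv] := eqVneq v (vtx (4 * k + 1)).
  by exists [:: v]; split; rewrite //= andbT hv hub.
by exists [:: vtx (4 * k + 1); v]; split; rewrite //= hub // hub'.
Qed.

Lemma gadget_weights X Y : weights_le (gadget X Y) (n ^ 1).
Proof. by move=> u v _; rewrite expn1 /= /gwt; (repeat case: ifP); lia. Qed.

(** * Paths and detours in the gadget *)

Section Paths.
Variables X Y : rel nat.
Let I := gadget X Y.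

Fixpoint npw (x : nat) (s : seq nat) : nat :=
  if s is y :: s' then gwt x y + npw y s' else 0.

Lemma npw_cat x s1 s2 : npw x (s1 ++ s2) = npw x s1 + npw (last x s1) s2.
Proof. by elim: s1 x => //= y s1 IH x; rewrite IH addnA. Qed.

Lemma path_vtx x s : all (fun a => a < n) (x :: s) ->
  path (adj I) (vtx x) (map vtx s) = path (gadj X Y) x s.
Proof.
elim: s x => //= y s IH x /and3P[hx hy hs].
by rewrite IH /= ?hy // !vtxK.
Qed.

Lemma pweight_vtx x s : all (fun a => a < n) (x :: s) ->
  pweight I (vtx x) (map vtx s) = npw x s.
Proof.
elim: s x => //= y s IH x /and3P[hx hy hs].
by rewrite IH /= ?hy // !vtxK.
Qed.

Lemma uniq_vtx s : all (fun a => a < n) s -> uniq (map vtx s) = uniq s.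
Proof.
move=> /allP h; apply: map_inj_in_uniq => a b /h ha /h hb e.
by rewrite -(vtxK ha) e vtxK.
Qed.

Lemma gwt_leave i j : i < k -> j < k -> gwt i (k + 1 + j) = k - i.
Proof. by move=> hi hj; rewrite /gwt ifT //; lia. Qed.

Lemma gwt_return i a : i < k -> a <= k -> gwt (3 * k + 1 + i) a = i.
Proof. by move=> hi ha; rewrite /gwt ifF ?ifT; lia. Qed.

Lemma gwt_cross u v : k < u < 3 * k + 1 -> gwt u v = 0.
Proof. by move=> hu; rewrite /gwt !ifF; lia. Qed.

Lemma path_spine a m : a + m <= k -> path (gadj X Y) a (iota a.+1 m).
Proof.
elim: m a => //= m IH a h; rewrite IH; last by lia.
by rewrite andbT /gadj; lia.
Qed.

Lemma npw_spine a m : a + m <= k -> npw a (iota a.+1 m) = 0.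
Proof.
elim: m a => //= m IH a h; rewrite IH; last by lia.
by rewrite /gwt; (repeat case: ifP); lia.
Qed.

Lemma last_iota a m : last a (iota a.+1 m) = a + m.
Proof. by elim: m a => [|m IH] a /=; rewrite ?addn0 // IH; lia. Qed.

Lemma iota_lt a m : a + m <= n -> all (fun b => b < n) (iota a m).
Proof. by move=> h; apply/allP => b; rewrite mem_iota; lia. Qed.

Lemma st_path_spine : st_path I (Pst I).
Proof.
rewrite /st_path /= eqxx (path_vtx (x := 0)); last by apply: (@iota_lt 0 k.+1); lia.
rewrite path_spine // last_map last_iota add0n eqxx /=.
have : uniq (map vtx (iota 0 k.+1)) by rewrite uniq_vtx ?iota_uniq ?iota_lt //; lia.
by [].
Qed.

(** Spine edges weigh 0, so the spine is a shortest path whatever [X] and [Y] are. *)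
Lemma gadget_valid : valid_instance I.
Proof.
split; last split.
- move=> v; rewrite /= /gadj; lia.
- exact: st_path_spine.
move=> q _; rewrite /weight /= (pweight_vtx (x := 0)) ?npw_spine //.
by apply: (@iota_lt 0 k.+1); lia.
Qed.

Lemma nedges_gadget : nedgesP I = k.
Proof. by rewrite /nedgesP /= size_map size_iota. Qed.

Lemma edgeP_gadget i : i < k -> edgeP I i = (vtx i, vtx i.+1).
Proof.
move=> hi; have N m : m <= k -> nth (src I) (Pst I) m = vtx m.
  by move=> hm; rewrite (nth_map 0) ?size_iota // nth_iota.
by rewrite /edgeP !N //; lia.
Qed.

(** Leave the spine at [i], cross through column [j] and return to [i.+1], at cost [(k - i) + i]. *)
Lemma detour_exists i j : i < k -> j < k -> X i j -> Y i j -> short_detour I k.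
Proof.
move=> hi hj hX hY.
pose s := iota 1 i ++ [:: k + 1 + j; 2 * k + 1 + j; 3 * k + 1 + i] ++ iota i.+1 (k - i).
have all_s : all (fun b => b < n) (0 :: s).
  by rewrite /= !all_cat !iota_lt /=; lia.
have uniq_s : uniq (0 :: s).
  have D1 : ~~ has (mem (iota 0 i.+1))
    ([:: k + 1 + j; 2 * k + 1 + j; 3 * k + 1 + i] ++ iota i.+1 (k - i)).
    by apply/hasPn => a; rewrite mem_cat !inE !mem_iota; lia.
  have D2 : ~~ has (mem [:: k + 1 + j; 2 * k + 1 + j; 3 * k + 1 + i]) (iota i.+1 (k - i)).
    by apply/hasPn => a; rewrite !inE !mem_iota; lia.
  have D3 : uniq [:: k + 1 + j; 2 * k + 1 + j; 3 * k + 1 + i] by rewrite /= !inE; lia.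
  by rewrite -cat1s catA -[[:: 0] ++ _]/(iota 0 i.+1) !cat_uniq !iota_uniq D1 D2 D3.
have path_s : path (gadj X Y) 0 s.
  rewrite !cat_path path_spine ?last_iota /=; last by lia.
  have E1 : i < k /\ k + 1 + j - (k + 1) = j /\ 3 * k + 1 + i - (3 * k + 1) = i
    /\ 2 * k + 1 + j - (2 * k + 1) = j by lia.
  rewrite add0n.
  have -> : gadj X Y i (k + 1 + j) by rewrite /gadj; have [? [-> _]] := E1; rewrite hX; lia.
  have -> : gadj X Y (k + 1 + j) (2 * k + 1 + j) by rewrite /gadj; lia.
  have -> : gadj X Y (2 * k + 1 + j) (3 * k + 1 + i).
    by rewrite /gadj; have [? [_ [-> ->]]] := E1; rewrite hY; lia.
  rewrite /=; have -> : k - i = (k - i.+1).+1 by lia.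
  rewrite /= path_spine ?andbT; last by lia.
  by rewrite /gadj; lia.
have npw_s : npw 0 s = k.
  rewrite !npw_cat npw_spine ?last_iota; last by lia.
  rewrite add0n /=; have -> : k - i = (k - i.+1).+1 by lia.
  rewrite /= npw_spine; last by lia.
  by rewrite gwt_leave // gwt_return ?gwt_cross; lia.
exists (map vtx (0 :: s)); split.
- apply/and4P; split=> //; first by rewrite path_vtx.
    rewrite last_map /s !last_cat /=; apply/eqP; congr vtx.
    have -> : k - i = (k - i.+1).+1 by lia.
    by rewrite /= last_iota; lia.
  by rewrite -(uniq_vtx all_s) in uniq_s.
- exists i; first by rewrite nedges_gadget.
  (* Vertex [i] occurs only at position [i], where its successor is [k + 1 + j] and not [i.+1]. *)
  rewrite /avoids edgeP_gadget //; apply/negP => /(mem_edgesP (vtx 0))[m].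
  rewrite size_map => hm; have hm' := ltnW hm; rewrite !(nth_map 0) //.
  have nthlt a : a < size (0 :: s) -> nth 0 (0 :: s) a < n.
    by move=> ?; apply: (allP all_s); exact: mem_nth.
  have si : i < size (0 :: s) by rewrite /= !size_cat !size_iota /=; lia.
  have ni : nth 0 (0 :: s) i = i.
    by rewrite -cat1s catA -[[:: 0] ++ _]/(iota 0 i.+1) nth_cat size_iota ltnSn nth_iota.
  have ni1 : nth 0 (0 :: s) i.+1 = k + 1 + j.
    by rewrite -cat1s catA -[[:: 0] ++ _]/(iota 0 i.+1) nth_cat size_iota ltnn subnn.
  move: (nthlt _ hm) (nthlt _ hm'); set a := nth _ _ m; set b := nth _ _ m.+1 => hb ha [].
  move=> /(f_equal (@nat_of_ord n)); rewrite !vtxK //; last by lia.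
  rewrite -[X in X = _]ni => /eqP; rewrite nth_uniq // => /eqP im.
  move=> /(f_equal (@nat_of_ord n)); rewrite !vtxK //; last by lia.
  by rewrite /b -im ni1; lia.
by rewrite /weight /= pweight_vtx // npw_s.
Qed.

(** The sink has no way out, so it lowers the diameter without opening any detour. *)
Lemma hub_stuck v : ~ gadj X Y (4 * k + 1) v.
Proof. rewrite /gadj; lia. Qed.

Lemma spine_step a v : a <= k -> gadj X Y a v -> v <> 4 * k + 1 ->
  a < k /\ (v = a.+1 \/ exists j, [/\ j < k, v = k + 1 + j & X a j]).
Proof.
move=> ha; case/or4P=> [|||/or3P[||]]; try lia.
case/and3P=> h1 h2 hX _; split=> //; right; exists (v - (k + 1)); split=> //; lia.
Qed.

Lemma column_step j v : j < k -> gadj X Y (k + 1 + j) v -> v <> 4 * k + 1 -> v = 2 * k + 1 + j.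
Proof. by move=> hj; rewrite /gadj; lia. Qed.

Lemma column'_step j v : j < k -> gadj X Y (2 * k + 1 + j) v -> v <> 4 * k + 1 ->
  exists i, [/\ i < k, v = 3 * k + 1 + i & Y i j].
Proof.
move=> hj; case/or4P=> [|||/or3P[||]]; try lia.
case/and3P=> h1 h2 hY _; exists (v - (3 * k + 1)); split; try lia.
by have -> : j = 2 * k + 1 + j - (2 * k + 1) by lia.
Qed.

Lemma row_step i v : i < k -> gadj X Y (3 * k + 1 + i) v -> v <> 4 * k + 1 -> v = i.+1.
Proof. by move=> hi; rewrite /gadj; lia. Qed.

Lemma cons_not_hub (y : 'I_n) p : path (adj I) y p -> last y p = vtx k -> y <> 4 * k + 1 :> nat.
Proof.
case: p => [_ /= ->|z p /=]; first by rewrite vtxK; lia.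
by move=> /andP[h _] _ e; move: h; rewrite e => /hub_stuck.
Qed.

(* A simple path that leaves row i at cost k - i must come back behind i, at a
   row i' >= i, at cost i'; so total cost at most k forces i' = i. *)
Lemma detour_meets p (x : 'I_n) : x <= k -> path (adj I) x p -> last x p = vtx k ->
  uniq p -> (forall v : 'I_n, v \in p -> ~~ (v <= x)) -> pweight I x p <= k ->
  p = map vtx (iota x.+1 (k - x)) \/ exists i j, [/\ i < k, j < k, X i j & Y i j].
Proof.
elim: p x => [|y p IH] x hx.
  move=> _ /= -> _ _ _; left; rewrite vtxK ?subnn //; lia.
move=> /= /andP[hxy hp] hl /andP[yp up] hv hw.
have [xk [hy|[j [hj hy hX]]]] := spine_step hx hxy (cons_not_hub hp hl).
  (* A spine step preserves the invariant that the rest of the path stays off the spine up to the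
     current vertex; simplicity excludes [y] itself. *)
  have hyk : y <= k by lia.
  have hv' (v : 'I_n) : v \in p -> ~~ (v <= y).
    move=> vp; rewrite hy; have := hv v; rewrite inE vp orbT => /(_ isT).
    suff : v <> y :> nat by lia.
    by move=> /ord_inj e; rewrite -e vp in yp.
  have hw' : pweight I y p <= k by lia.
  have [->|] := IH y hyk hp hl up hv' hw'; last by right.
  left; have -> : k - x = (k - y).+1 by lia.
  by rewrite /= -hy valK_vtx.
(* Off the spine only [i] is free: column [j], its copy, return node [i], then [i.+1]. *)
case: p hp hl yp up hv hw {IH} => [_ /= e|u p /= /andP[hyu hp] hl yp up hv hw].
  by move: hy; rewrite e vtxK; lia.
rewrite hy in hyu; have hu := column_step hj hyu (cons_not_hub hp hl).
case: p hp hl yp up hv hw => [_ /= e|l p /= /andP[hul hp] hl yp up hv hw].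
  by move: hu; rewrite e vtxK; lia.
rewrite hu in hul; have [i [hi hli hY]] := column'_step hj hul (cons_not_hub hp hl).
case: p hp hl yp up hv hw => [_ /= e|z p /= /andP[hlz hp] hl yp up hv hw].
  by move: hli; rewrite e vtxK; lia.
rewrite hli in hlz; have hz := row_step hi hlz (cons_not_hub hp hl).
have := hv z; rewrite !inE eqxx !orbT => /(_ isT) hzx.
right; exists x, j; split=> //; suff -> : x = i :> nat by [].
(* Landing at [i.+1] beyond [x] gives [x <= i]; the weight, at least [(k - x) + i], gives the
   converse. *)
have xi : x <= i by rewrite -ltnS -hz ltnNge.
move: hw; rewrite hy hu hli hz gwt_leave // gwt_return // => hw.
apply/eqP; rewrite eqn_leq xi -(leq_add2l (k - x)) subnK //.
apply: leq_trans hw; rewrite leq_add2l.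
by do 2 (apply: leq_trans _ (leq_addl _ _)); apply: leq_addr.
Qed.

Lemma short_detour_meets : short_detour I k ->
  exists i j, [/\ i < k, j < k, X i j & Y i j].
Proof.
case=> -[|x p] [] //= /and4P[/eqP hx hp /eqP hl /andP[xp up]] [i hi hav] hw.
have x0 : x = 0 :> nat by rewrite hx vtxK //; lia.
have xk : x <= k by rewrite x0.
have hv (v : 'I_n) : v \in p -> ~~ (v <= x).
  move=> vp; rewrite x0 leqn0; apply: contra xp => /eqP v0.
  by have -> : x = v by apply: ord_inj; rewrite /= v0.
have [e|//] := detour_meets xk hp hl up hv hw.
(* The remaining case is the spine itself, which avoids none of its own edges. *)
case/negP: hav; have -> : x :: p = Pst I by rewrite e x0 hx subn0.
apply/(mem_edgesP (src I)); exists i => //.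
Qed.
End Paths.
End Gadget.

(** * The round lower bound *)

Definition cells k (x : {set 'I_k * 'I_k}) : rel nat :=
  fun i j => [exists e in x, (e.1 == i :> nat) && (e.2 == j :> nat)].

Lemma short_detour_cells n k (k_gt0 : 0 < k) (n_ge : 4 * k + 2 <= n)
    (x y : {set 'I_k * 'I_k}) :
  short_detour (gadget k_gt0 n_ge (cells x) (cells y)) k <-> ~~ [disjoint x & y].
Proof.
split=> [/short_detour_meets[i [j [_ _ /exists_inP[e ex /andP[/eqP ei /eqP ej]]]]]|].
  case/exists_inP=> f fy /andP[/eqP fi /eqP fj]; apply/pred0Pn; exists e; rewrite /= ex.
  suff -> : e = f by [].
  case: e f ei ej fi fj {ex fy} => [a b] [a' b'] /= <- <- aa bb.
  by congr pair; apply: ord_inj.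
case/pred0Pn=> -[i j] /= /andP[hx hy].
apply: (detour_exists k_gt0 n_ge (ltn_ord i) (ltn_ord j));
  by apply/exists_inP; exists (i, j); rewrite ?eqxx.
Qed.

(** Two steps of [j] gain a factor 2, because [2 * 16 ^ 2 = 512 <= 729 = 27 ^ 2]. *)
Lemma pow_27_16 j : 2 ^ j./2 * 16 ^ j <= 27 ^ j.
Proof.
rewrite -{2 3}(odd_double_half j) -addnn; move: (odd j) j./2 => o h.
rewrite !(expnD _ o) !(expnD _ h).
have e1 : 2 ^ h * (16 ^ h * 16 ^ h) = (2 * (16 * 16)) ^ h by rewrite !expnMn.
have e2 : 27 ^ h * 27 ^ h = (27 * 27) ^ h by rewrite expnMn.
rewrite mulnCA e1 e2; apply: leq_mul; first by case: o.
by case: h {e1 e2} => // m; rewrite leq_exp2r.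
Qed.

Lemma leq_exponents a b h e c : 0 < c ->
  2 ^ a * (2 ^ h * c) <= 2 ^ b * (2 ^ e * c) -> a + h <= b + e.
Proof.
by move=> c0; rewrite !mulnA -!expnD leq_pmul2r // leq_exp2l.
Qed.

Lemma const_le : 3 ^ 13 * 136 <= 2 ^ 34.
Proof.
have -> : 2 ^ 34 = (2 * 2) ^ 13 * 2 ^ 8 by rewrite expnMn -!expnD.
by apply: leq_mul; rewrite ?leq_exp2r.
Qed.

(** Comparing exponents of 2 bounds [j./2], about [k * k / 544], by [104 * k * B * T + 22]; for
    [160 <= k] the additive constants amount to at most half of [k * k]. *)
Lemma rounds_from_entropy k B T : 160 <= k ->
  2 ^ 12 * 27 ^ (k * k %/ 272) <=
  3 ^ 13 * 136 * (((2 ^ B * 2 ^ B) ^ (T * (4 * k))) ^ 13 * 16 ^ (k * k %/ 272)) ->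
  k <= 272 * 416 * (B * T).
Proof.
move=> hk; set j := k * k %/ 272 => H.
have {H} : 12 + j./2 <= 34 + (B + B) * (T * (4 * k) * 13).
  apply: (leq_exponents (c := 16 ^ j)); first by rewrite expn_gt0.
  apply: leq_trans (leq_mul (leqnn _) (pow_27_16 j)) _; apply: (leq_trans H).
  rewrite -expnD -!expnM; exact: leq_mul const_le (leqnn _).
have : k * k < 272 * j.+1 by rewrite /j; lia.
have : j <= j./2 + j./2 + 1 by lia.
move: (j./2) => h; clearbody j => h1 h2 h3.
have h4 : k * k <= k * (272 * 208 * (B * T)) + 272 * 46 by nia.
have h5 : 160 * k <= k * k by rewrite leq_mul2r hk orbT.
have h6 : k * k <= k * (272 * 416 * (B * T)) by lia.
by rewrite -(leq_pmul2l (m := k)) //; lia.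
Qed.

(** [P] is a test that each vertex runs on its own output; unanimous acceptance stands for
    disjointness. *)
Lemma round_lower_bound_of_test (O : nat -> Type)
  (correct : forall n, instance n -> ('I_n -> O n) -> Prop)
  (P : forall n, nat -> nat -> pred (O n)) :
  (forall n (I : instance n) out b, correct n I out ->
     short_detour I b <-> ~~ [forall v, P n (nedgesP I) b (out v)]) ->
  round_lower_bound O correct.
Proof.
(* The constant covers [5 * 272 * 416], since [n <= 5 * k]; [650 <= n] ensures [160 <= k]. *)
move=> hP; exists 2, 1 => cB cB0; exists (600 * 1000 * cB), 650; split; first by lia.
move=> n hn L T S A solves; set B := cB * trunc_log 2 n in A solves *.
pose k := (n - 2) %/ 4.
have k0 : 0 < k by rewrite /k; lia.
have nk : 4 * k + 2 <= n by rewrite /k; lia.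
pose inst (x y : {set 'I_k * 'I_k}) := gadget k0 nk (cells x) (cells y).
pose tr r x y := transcript T A inst (cut k0 nk) r x y.
pose acc r x y := [forall v, P n k k (outputs A (inst x y) r T v)].
have good x y := solves (inst x y) (gadget_valid k0 nk _ _)
   (conj (@gadget_undiam _ _ k0 nk _ _) (@gadget_weights _ _ k0 nk _ _)).
have testP x y out : correct n (inst x y) out ->
   ~~ [disjoint x & y] <-> ~~ [forall v, P n k k (out v)].
  by move=> ok; rewrite -(short_detour_cells k0 nk) (hP _ _ _ _ ok) nedges_gadget.
have ha x y y' r (v : 'I_n) : alice k v ->
    local_inp (inst x y) r v = local_inp (inst x y') r v :> local_input n L.
  exact: gadget_alice.
have hb x x' y r (v : 'I_n) : ~~ alice k v ->
    local_inp (inst x y) r v = local_inp (inst x' y) r v :> local_input n L.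
  exact: gadget_bob.
have hc x y (u v : 'I_n) : comm (inst x y) u v -> alice k u -> ~~ alice k v ->
    exists e, cut k0 nk e = (u, v).
  exact: cut_cover.
have hj : 272 * (k * k %/ 272) <= #|{: 'I_k * 'I_k}|.
  by rewrite card_prod card_ord mulnC leq_trunc_div.
have key := @disjointness_bound _ _ _ tr acc _ _ _ _ _ _ _ hj.
have {}key : 2 ^ 12 * 27 ^ (k * k %/ 272) <=
  3 ^ 13 * 136 * (((2 ^ B * 2 ^ B) ^ (T * (4 * k))) ^ 13 * 16 ^ (k * k %/ 272)).
  have <- : #|{ffun 'I_T * 'I_(4 * k) -> B.-tuple bool * B.-tuple bool}|
     = (2 ^ B * 2 ^ B) ^ (T * (4 * k)).
    by rewrite card_ffun !card_prod !card_tuple card_bool !card_ord.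
  apply: key.
  - move=> r x y x' y'.
    exact: transcript_cut ha hb (@cut_alice _ _ k0 nk) (@cut_bob _ _ k0 nk) hc _ _ _ _ _.
  - move=> r x y x' y'; exact: accept_cut ha hb hc _ _ _ _ _ _.
  (* On disjoint sets every successful random string accepts. *)
  - move=> x y xy; have [G [Gok Gcard]] := good x y.
    apply: leq_trans (_ : 3 * #|G| <= _); first by rewrite -cardsT.
    rewrite leq_mul2l /=; apply/subset_leq_card/subsetP => r /Gok /testP h.
    rewrite inE; apply/negPn/negP => /h; by rewrite xy.
  (* On intersecting sets no successful string accepts, so at most a third of all strings do. *)
  - move=> x y xy; have [G [Gok Gcard]] := good x y.
    have le : #|[set r | acc r x y]| + #|G| <= #|{ffun 'I_n -> L.-tuple bool}|.
      rewrite -(cardsC G) addnC leq_add2l; apply/subset_leq_card/subsetP => r.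
      by rewrite !inE => hr; apply/negP => /Gok /testP /iffLR /(_ xy); rewrite -/(acc r x y) hr.
    rewrite cardsT in Gcard; rewrite -(leq_add2r (3 * #|G|)) -mulnDr.
    by apply: leq_trans (leq_mul (leqnn 3) le) _; rewrite (mulSn 2) leq_add2l.
  - by apply/card_gt0P; exists [ffun=> [tuple of nseq L false]].
  - by rewrite card_prod card_ord muln_gt0 k0.
have hk : 160 <= k by rewrite /k; lia.
have := rounds_from_entropy hk key.
have : n <= 5 * k by rewrite /k; lia.
rewrite /B; clear; move: (trunc_log 2 n) => l h1 h2.
have : 5 * k <= 5 * (272 * 416 * (cB * l * T)) by rewrite leq_mul2l.
lia.
Qed.

Theorem theorem1 :
  round_lower_bound out_RP RP_correct /\ round_lower_bound out_2S SiSP_correct.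
Proof.
(* No claim and a claim of infinity both pass; only a finite claim of at most [b] fails. *)
pose long b (d : option (option nat)) := if d is Some (Some x) then b < x else true.
split.
- apply: (round_lower_bound_of_test
    (P := fun n m b o => all (fun i => long b (o i).1) (iota 0 m))) => n I out b ok.
  split=> [[q [hq [i hi av] hw]]|].
    have [[v hv] spec] := ok i hi; apply/forallPn; exists v; apply/allPn; exists i.
      by rewrite mem_iota.
    case E: (out v i).1 hv => [[x|]|] // _; have [] := spec v _ E.
      by move=> [_ le] _; rewrite /= -leqNgt; apply: leq_trans (le q hq av) hw.
    by move=> /(_ q hq); rewrite av.
  case/forallPn=> v /allPn[i]; rewrite mem_iota add0n => /= hi.
  case E: (out v i).1 => [[x|]|] //=; rewrite -leqNgt => xb.
  have [_ spec] := ok i hi; have [[[q [hq av wq]] _] _] := spec v _ E.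
  by exists q; split; rewrite ?wq //; exists i.
- apply: (round_lower_bound_of_test (P := fun n m b o => long b o.1)) => n I out b [[v hv] spec].
  split=> [[q [hq mq hw]]|].
    apply/forallPn; exists v.
    case E: (out v).1 hv => [[x|]|] // _; have [] := spec v _ E.
      by move=> [_ le] _; rewrite /= -leqNgt; apply: leq_trans (le q hq mq) hw.
    by move=> /(_ q hq).
  case/forallPn=> u; case E: (out u).1 => [[x|]|] //=; rewrite -leqNgt => xb.
  have [[[q [hq mq wq]] _] _] := spec u _ E.
  by exists q; split; rewrite ?wq.
Qed.
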